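(* As $n\to\infty$, $$f(n)\ \ge\ \sqrt{\frac{2}{\pi}}\,\frac{2^n}{\sqrt n}\left(1+\frac{5}{12n}+O(n^{-2})\right)\quad\text{for } n \text{ even},$$ and $$f(n)\ \ge\ \sqrt{\frac{2}{\pi}}\,\frac{2^n}{\sqrt n}\left(1+\frac{7}{12n}+O(n^{-2})\right)\quad\text{for } n \text{ odd}.$$
   Context: For a finite set $A=\{a_1<\cdots<a_n\}$ of positive integers, $A$ has pairwise distinct subset sums if the $2^n$ numbers $w(S)=\sum_{i\in S}a_i$, $S\subseteq\{1,\dots,n\}$ (with $w(\emptyset)=0$), are pairwise distinct. Define $f(n)$ as the minimum of the largest element $a_n$ over all $n$-element sets $A$ of positive integers having pairwise distinct subset sums. An inequality $f(n)\ge g(n)(1+c/n+O(n^{-2}))$ means that $f(n)\ge g(n)(1+c/n+\varepsilon_n)$ for some sequence $\varepsilon_n$ with $\varepsilon_n=O(n^{-2})$. *)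

(* Defs.v *)
From HB Require Import structures.
From mathcomp Require Import all_boot all_order all_algebra.
From mathcomp Require Import all_classical all_reals all_analysis.
Set Implicit Arguments.
Unset Strict Implicit.
Unset Printing Implicit Defensive.

Definition subset_sum (n : nat) (a : n.-tuple nat) (S : {set 'I_n}) : nat :=
  \sum_(i in S) tnth a i.

Definition distinct_subset_sums (n : nat) (a : n.-tuple nat) : Prop :=
  injective (subset_sum a).

(* An n-element set {a_1 < ... < a_n} of positive integers is represented by   *)
(* its increasing enumeration, so that its largest element is the last entry   *)
(* of the tuple (by convention 0 for the empty set).                           *)
Definition max_of_distinct_sum_set (n m : nat) : Prop :=
  exists a : n.-tuple nat,
    [/\ sorted ltn a, all (leq 1) a, distinct_subset_sums a & last 0 a = m].

Lemma binary_inj (n : nat) (b c : nat -> bool) :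
  \sum_(i < n) b i * 2 ^ i = \sum_(i < n) c i * 2 ^ i ->
  forall i, i < n -> b i = c i.
Proof.
elim: n b c => [//|n IHn] b c.
have shift (d : nat -> bool) :
    \sum_(i < n.+1) d i * 2 ^ i
    = d 0 + (\sum_(i < n) d i.+1 * 2 ^ i).*2.
  rewrite big_ord_recl /= expn0 muln1; congr (_ + _).
  rewrite -mul2n big_distrr /=; apply: eq_bigr => i _.
  by rewrite /bump add1n expnS mulnCA.
rewrite !shift => eq_bc.
have eq0 : b 0 = c 0.
  by have /(congr1 odd) := eq_bc; rewrite !oddD !odd_double !addbF !oddb.
move: eq_bc; rewrite eq0 => /addnI/double_inj eqS [//|i].
exact: (IHn (b \o succn) (c \o succn) eqS).
Qed.

Lemma powers_of_two_distinct_sums (n : nat) :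
  distinct_subset_sums [tuple 2 ^ i | i < n].
Proof.
have sumE (S : {set 'I_n}) : subset_sum [tuple 2 ^ i | i < n] S
    = \sum_(i < n) (nat_of_ord i \in map val (enum S)) * 2 ^ i.
  rewrite /subset_sum big_mkcond /=; apply: eq_bigr => i _.
  rewrite tnth_mktuple mem_map ?mem_enum; last exact: val_inj.
  by case: (i \in S); rewrite ?mul1n.
move=> S T; rewrite !sumE => eqST; apply/setP => i.
have := binary_inj (b := fun k => k \in map val (enum S))
                   (c := fun k => k \in map val (enum T)) eqST (ltn_ord i).
by rewrite /= !mem_map ?mem_enum //; exact: val_inj.
Qed.

Lemma max_of_distinct_sum_set_exists (n : nat) :
  exists m : nat, `[< max_of_distinct_sum_set n m >].
Proof.
pose a : n.-tuple nat := [tuple 2 ^ i | i < n].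
exists (last 0 a); apply/asboolP; exists a; split=> //.
- rewrite /a /= -[enum 'I_n]/(enum 'I_n) (map_comp (expn 2) val) val_enum_ord.
  rewrite sorted_map; apply: sub_sorted (iota_ltn_sorted 0 n) => i j /= ij.
  by rewrite ltn_exp2l.
- by apply/allP => x /mapP[i _ ->]; rewrite expn_gt0.
- exact: powers_of_two_distinct_sums.
Qed.

Definition min_largest_element (n : nat) : nat :=
  ex_minn (max_of_distinct_sum_set_exists n).

(* Main.v *)
(* Let [N t] be the number of subset sums below [t], and let [a] be the largest
   weight. A vertex-isoperimetric inequality on the cube, restricted to the
   threshold families {S | w(S) < t}, bounds [N (t + a)] from below in terms of
   [N t]; since the sums are distinct, [N (t + a) <= N t + a] and [N] takes
   every value up to [2 ^ n]. Instead of a Hamming ball one uses a family that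
   cuts a middle layer in the proportion 1/3, where the Takagi function, which
   governs shadows of partial layers, is maximal. This gives
     f(2m) >= C(2m, m) + Cat_1 + ... + Cat_(m-1),
     f(2m+1) >= C(2m+1, m) + Cat_1 + ... + Cat_m,
   and Cat_1 + ... + Cat_(m-1) >= C(2m, m) / (3 (m + 1)). The constant [pi] enters
   through Wallis' estimate of the central binomial coefficient. *)
Require Import Defs.
From HB Require Import structures.
From mathcomp Require Import all_boot all_order all_algebra.
From mathcomp Require Import all_classical all_reals all_analysis.
From mathcomp Require Import zify ring lra.
Set Implicit Arguments.
Unset Strict Implicit.
Unset Printing Implicit Defensive.

(** * Counting subset sums below a threshold *)

Fixpoint masks (n : nat) : seq bitseq :=
  if n is n'.+1 then map (cons false) (masks n') ++ map (cons true) (masks n')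
  else [:: [::]].

Definition subset_sums (s : seq nat) : seq nat :=
  [seq sumn (mask b s) | b <- masks (size s)].

Definition sums_below (s : seq nat) (t : nat) : nat :=
  count (fun w => w < t) (subset_sums s).

Lemma size_masks n : size (masks n) = 2 ^ n.
Proof.
by elim: n => //= n IHn; rewrite size_cat !size_map IHn expnS mul2n addnn.
Qed.

Lemma masks_uniq n : uniq (masks n).
Proof.
elim: n => //= n IHn.
rewrite cat_uniq !map_inj_uniq ?IHn ?andbT /=; try by move=> ? ? [].
by apply/hasPn => _ /mapP[b _ ->]; apply/mapP => -[].
Qed.

Lemma size_in_masks n b : b \in masks n -> size b = n.
Proof.
elim: n b => [|n IHn] b /=; first by rewrite inE => /eqP ->.
by rewrite mem_cat => /orP[] /mapP[c /IHn <- ->].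
Qed.

Lemma sums_below_nil t : sums_below [::] t = (0 < t).
Proof. by rewrite /sums_below /= addn0. Qed.

(** Split by whether [x] is chosen. Truncation is harmless: for [t <= x] the second count is at
    threshold 0, hence 0. *)
Lemma sums_below_cons x s t :
  sums_below (x :: s) t = sums_below s t + sums_below s (t - x).
Proof.
rewrite /sums_below /subset_sums /= map_cat count_cat -!map_comp.
congr (_ + _); rewrite !count_map; apply: eq_count => b /=; lia.
Qed.

Lemma sums_below0 s : sums_below s 0 = 0.
Proof. by rewrite /sums_below (@eq_count _ _ pred0) ?count_pred0. Qed.

Lemma leq_sums_below s t u : t <= u -> sums_below s t <= sums_below s u.
Proof. by move=> tu; apply: sub_count => w /= /leq_trans; apply. Qed.

Lemma leq_sumn_mask b s : sumn (mask b s) <= sumn s.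
Proof.
elim: s b => [|x s IHs] [|[] b] //=; rewrite ?leq_add2l //.
exact: leq_trans (IHs b) (leq_addl _ _).
Qed.

Lemma sums_below_full s : sums_below s (sumn s).+1 = 2 ^ size s.
Proof.
rewrite -size_masks /sums_below /subset_sums -(size_map (fun b => sumn (mask b s))).
apply/eqP; rewrite -all_count; apply/allP => _ /mapP[b _ ->].
by rewrite ltnS leq_sumn_mask.
Qed.

(** * Isoperimetry for threshold families *)

(* Without the subtraction this would be the size of a Hamming ball. The
   argument of [sums_below_shift] tolerates lowering [harper n.+1 r.+1] by 1,
   and [harper] does so whenever this raises [harper n r.+1 - harper n r] in
   the middle layers; it is then the size of a Hamming ball from which about a
   third of the outermost layer is removed (see [harperE]). *)
Fixpoint harper (n r : nat) : nat :=
  if n is n'.+1 then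
    if r is r'.+1 then harper n' r + harper n' r' - (0 < r') && (r'.*2 <= n')
    else 0
  else (0 < r).

Lemma harper_gt0 n r : 0 < r -> 0 < harper n r.
Proof.
elim: n r => [|n IHn] [|r] //= _.
by have := IHn r.+1 isT; have := IHn r; case: r => [|r] //=; lia.
Qed.

Lemma harper1 n : harper n 1 = 1.
Proof. by elim: n => //= n ->; case: n. Qed.

Lemma harper_le n r : harper n r <= 2 ^ n.
Proof.
elim: n r => [|n IHn] [|r] //=.
by rewrite expnS; have := IHn r.+1; have := IHn r; lia.
Qed.

(* Remove the largest weight [x] and let [m0], [m1] count the sums of the rest
   below [t] and [t - x]. If [m0] is too small for the induction hypothesis
   then [m1] is large, but the hypothesis at [t - x] with radius [r - 1]
   then shows that [m0] was large after all. *)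
Lemma sums_below_shift s a r t :
    sorted geq s -> all (geq a) s -> 0 < r ->
  harper (size s) r <= sums_below s t ->
  harper (size s) r.+1 <= sums_below s (t + a).
Proof.
elim: s a r t => [|x s IHs] a r t.
  by move=> _ _ r0; rewrite !sums_below_nil /= r0; lia.
move=> xs /= /andP[xa _] r0.
have s_sorted : sorted geq s by apply: path_sorted xs.
have sx : all (geq x) s by apply: order_path_min xs => ? ? ?; rewrite /geq /=; lia.
case: r r0 => // r _ hr.
(* Shifting by [x] suffices, and then the subsets containing [x] are counted at [t] itself. *)
apply: leq_trans (leq_sums_below _ (_ : t + x <= _)); last by rewrite leq_add2l.
move: hr; rewrite !sums_below_cons addnK => hr.
suff m0 : harper (size s) r.+1 <= sums_below s t.
  by have := IHs x r.+1 t s_sorted sx isT m0; lia.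
rewrite leqNgt; apply/negP => m0.
(* The strict inequality [m0] gains 1, which pays for the 1 that [harper] may subtract. *)
have m1 : harper (size s) r <= sums_below s (t - x) by move: hr; rewrite /=; lia.
case: r => [|r] in hr m0 m1.
  by move: hr m0; rewrite !harper1 /=; have := @leq_sums_below s (t - x) t; lia.
have := IHs x r.+1 (t - x) s_sorted sx isT m1.
(* Without truncation, shifting [t - x] by [x] gives back [t]. *)
have tx : 0 < t - x.
  rewrite lt0n; apply: contraTneq m1 => ->.
  by rewrite sums_below0 -ltnNge harper_gt0.
by rewrite subnK; lia.
Qed.

Lemma sums_belowD s t d :
  uniq (subset_sums s) -> sums_below s (t + d) <= sums_below s t + d.
Proof.
move=> Us; elim: d => [|d IHd]; first by rewrite !addn0.
rewrite !addnS; apply: leq_trans (_ : (sums_below s (t + d)).+1 <= _); last by [].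
have -> : sums_below s (t + d).+1
    = sums_below s (t + d) + count_mem (t + d) (subset_sums s).
  rewrite /sums_below -count_predUI (@eq_count _ (predI _ _) pred0) => [|w /=].
    by rewrite count_pred0 addn0; apply: eq_count => w /=; lia.
  lia.
by rewrite count_uniq_mem //; case: (_ \in _); lia.
Qed.

(** With distinct sums the count grows by at most 1 per unit of threshold, so the least threshold
    reaching [harper (size s) r] attains it exactly; from there [a] further units add at most
    [a]. *)
Lemma harper_step_le s a r :
    sorted geq s -> all (geq a) s -> uniq (subset_sums s) -> 0 < r ->
  harper (size s) r.+1 <= harper (size s) r + a.
Proof.
move=> ss sa Us r0.
have ex : exists t, harper (size s) r <= sums_below s t.
  by exists (sumn s).+1; rewrite sums_below_full harper_le.
case: (ex_minnP ex) => t ht tmin.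
have -> : harper (size s) r = sums_below s t.
  apply/eqP; rewrite eqn_leq ht /=.
  case: t => [|t] in ht tmin *; first by rewrite sums_below0.
  have := sums_belowD t 1 Us; rewrite addn1.
  by have := tmin t; rewrite ltnn; lia.
exact: leq_trans (sums_below_shift ss sa r0 ht) (sums_belowD _ _ Us).
Qed.

(** Each unit subtracted in [harper] propagates by Pascal's rule; term [j] collects all units
    subtracted at radius [j + 1]. *)
Lemma harperE n r :
  harper n r + \sum_(1 <= j < r) 'C(n - j.*2, r - j) = \sum_(i < r) 'C(n, i).
Proof.
elim: n r => [|n IHn] [|r]; try by rewrite big_geq ?big_ord0.
  rewrite big_nat big1 => [|j /andP[_ jr]]; last first.
    by rewrite sub0n bin0n subn_eq0 leqNgt jr.
  by rewrite big_ord_recl big1.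
have pascal : \sum_(i < r.+1) 'C(n.+1, i)
    = \sum_(i < r.+1) 'C(n, i) + \sum_(i < r) 'C(n, i).
  by rewrite !big_ord_recl !bin0 -addnA -big_split /=; congr (_ + _).
rewrite pascal -!IHn; case: r => [|r] in IHn pascal *.
  by rewrite !big_geq //= !addn0 subn0.
rewrite [in LHS]big_nat_recr //= [X in _ = _ + X + _]big_nat_recr //=.
have -> : \sum_(1 <= j < r.+1) 'C(n.+1 - j.*2, r.+2 - j)
   = \sum_(1 <= j < r.+1) 'C(n - j.*2, r.+2 - j)
     + \sum_(1 <= j < r.+1) 'C(n - j.*2, r.+1 - j).
  rewrite -big_split /=; apply: eq_big_nat => j /andP[j1 jr].
  rewrite (subSn (ltnW jr)); have [jn|nj] := leqP j.*2 n.
    by rewrite subSn // binS.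
  have -> : n.+1 - j.*2 = 0 by lia.
  have -> : n - j.*2 = 0 by lia.
  by rewrite !bin0n; lia.
rewrite subSnn !bin1.
(* Positivity ensures that subtracting 1 in [harper] never truncates. *)
have := harper_gt0 n (isT : 0 < r.+2).
set S1 := \sum_(_ <= _ < _) _; set S2 := \sum_(_ <= _ < _) _.
lia.
Qed.

(** * From sets of weights to decreasing lists *)

Lemma uniq_subset_sums n (a : n.-tuple nat) :
  distinct_subset_sums a -> uniq (subset_sums (rev a)).
Proof.
move=> inj_a; rewrite map_inj_in_uniq ?masks_uniq // => b c.
rewrite size_rev size_tuple => /size_in_masks bn /size_in_masks cn.
have sumE d : size d = n ->
    sumn (mask d (rev a)) = subset_sum a [set i : 'I_n | nth false (rev d) i].
  move=> dn; rewrite -[d in LHS]revK -rev_mask ?size_rev ?size_tuple //.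
  rewrite sumn_rev sumnE big_mask_tuple.
  by apply: eq_bigl => i; rewrite inE andbT.
rewrite !sumE // => /inj_a /setP eq_bc.
apply: (can_inj revK); apply: (@eq_from_nth _ false).
  by rewrite !size_rev bn cn.
move=> i; rewrite size_rev bn => lt_in.
by have := eq_bc (Ordinal lt_in); rewrite !inE.
Qed.

Lemma harper_step_min_largest_element n r : 0 < r ->
  harper n r.+1 <= harper n r + min_largest_element n.
Proof.
rewrite /min_largest_element; case: ex_minnP => m /asboolP[a [sa _ inj_a <-]] _ r0.
have a_size : size (rev a) = n by rewrite size_rev size_tuple.
rewrite -{1 2}a_size; apply: harper_step_le (uniq_subset_sums inj_a) r0.
  by rewrite rev_sorted; apply: sub_sorted sa => x y; apply: ltnW.
rewrite all_rev; case/lastP: (tval a) sa => [//|s x] sa.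
rewrite last_rcons all_rcons /= leqnn /=.
have geq_trans : transitive geq by move=> y z t; rewrite /geq /=; lia.
have sa' : sorted geq (rev (rcons s x)).
  by rewrite rev_sorted; apply: sub_sorted sa => y z; apply: ltnW.
by move: sa'; rewrite rev_rcons /= => /(order_path_min geq_trans); rewrite all_rev.
Qed.

Import Order.TTheory GRing.Theory Num.Theory.
Import numFieldNormedType.Exports.
Local Open Scope classical_set_scope.
Local Open Scope ring_scope.

(** * Catalan numbers and the exact lower bounds *)

Definition catalan (R : realFieldType) (i : nat) : R :=
  'C(i.*2, i)%:R / i.+1%:R.

Lemma catalan_even (R : realFieldType) i :
  catalan R i = 'C(i.*2, i)%:R - 'C(i.*2, i.+1)%:R.
Proof.
have /(congr1 (fun k => k%:R : R)) := mul_bin_left i.*2 i.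
rewrite -addnn addnK !natrM /catalan -addnn => e.
have i1 : i.+1%:R != 0 :> R by rewrite pnatr_eq0.
apply: (mulfI i1); rewrite mulrBr e mulrCA divff // mulr1.
by rewrite -mulrBl -natrB // subSnn mul1r.
Qed.

Lemma bin_double i : (0 < i)%N -> 'C(i.*2, i) = ('C(i.*2.-1, i) * 2)%N.
Proof.
case: i => // i _; rewrite doubleS binS /= muln2 -[RHS]addnn; congr (_ + _)%N.
by rewrite -[RHS]bin_sub; [congr 'C(_, _)|]; lia.
Qed.

Lemma catalan_odd (R : realFieldType) i : (0 < i)%N ->
  catalan R i = 'C(i.*2.-1, i)%:R - 'C(i.*2.-1, i.+1)%:R.
Proof.
move=> i0.
have e : i.+1%:R * 'C(i.*2.-1, i.+1)%:R = (i%:R - 1) * 'C(i.*2.-1, i)%:R :> R.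
  rewrite -[1]/(1%:R) -natrB // -!natrM mul_bin_left; congr (_ * _)%:R; lia.
rewrite /catalan (bin_double i0) natrM.
have i1 : i.+1%:R != 0 :> R by rewrite pnatr_eq0.
apply: (mulfI i1); rewrite mulrBr e mulrCA divff // mulr1 -natr1; ring.
Qed.

(** The step from radius [m] to [m + 1] adds the middle layer. With [i = m - j], the corrections in
    [harperE] differ by adjacent entries of row [2 i], as in [catalan_even]. *)
Lemma min_largest_element_even (R : realFieldType) m : (0 < m)%N ->
  'C(m.*2, m)%:R + \sum_(1 <= i < m) catalan R i <= (min_largest_element m.*2)%:R.
Proof.
move=> m0; rewrite (eq_bigr _ (fun i _ => catalan_even R i)) sumrB.
rewrite addrA lerBlDr -!natr_sum -!natrD ler_nat.
have := harper_step_min_largest_element m.*2 m0.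
have := harperE m.*2 m; have := harperE m.*2 m.+1.
rewrite big_ord_recr [in X in (_ + X)%N = _]big_nat_recr //=.
rewrite subnn bin0n subSnn /= addn0.
have reindex k : (\sum_(1 <= j < m) 'C(m.*2 - j.*2, m + k - j)
    = \sum_(1 <= i < m) 'C(i.*2, i + k))%N.
  rewrite big_nat_rev; apply: eq_big_nat => j /andP[j1 jm].
  by congr 'C(_, _); lia.
have := reindex 0%N; under [in X in X = _]eq_bigr do rewrite addn0.
under [in X in _ = X]eq_bigr do rewrite addn0.
move=> ->; have := reindex 1%N; under [in X in X = _]eq_bigr do rewrite addn1.
under [in X in _ = X]eq_bigr do rewrite addn1.
move=> ->; lia.
Qed.

(** Here the radius goes from [m + 1] to [m + 2], and [i = m + 1 - j] leads to row [2 i - 1], which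
    yields the same Catalan numbers. *)
Lemma min_largest_element_odd (R : realFieldType) m :
  'C(m.*2.+1, m)%:R + \sum_(1 <= i < m.+1) catalan R i
    <= (min_largest_element m.*2.+1)%:R.
Proof.
have -> : \sum_(1 <= i < m.+1) catalan R i
    = \sum_(1 <= i < m.+1) ('C(i.*2.-1, i)%:R - 'C(i.*2.-1, i.+1)%:R).
  by apply: eq_big_nat => i /andP[i0 _]; exact: catalan_odd.
rewrite sumrB addrA lerBlDr -!natr_sum -!natrD ler_nat.
have := harper_step_min_largest_element m.*2.+1 (ltn0Sn m).
have := harperE m.*2.+1 m.+1; have := harperE m.*2.+1 m.+2.
rewrite big_ord_recr [in X in (_ + X)%N = _]big_nat_recr //=.
(* The difference truncates to 0, so the last correction is ['C(0, 1)], which vanishes. *)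
have -> : (m.*2.+1 - m.+1.*2 = 0)%N by lia.
rewrite subSnn bin0n addn0.
have -> : 'C(m.*2.+1, m.+1) = 'C(m.*2.+1, m).
  by rewrite -[RHS]bin_sub; [congr 'C(_, _)|]; lia.
have reindex k : (\sum_(1 <= j < m.+1) 'C(m.*2.+1 - j.*2, m.+1 + k - j)
    = \sum_(1 <= i < m.+1) 'C(i.*2.-1, i + k))%N.
  rewrite big_nat_rev; apply: eq_big_nat => j /andP[j1 jm].
  by congr 'C(_, _); lia.
have := reindex 0%N; under [in X in X = _]eq_bigr do rewrite addn0.
under [in X in _ = X]eq_bigr do rewrite addn0.
move=> ->; have := reindex 1%N; under [in X in X = _]eq_bigr do rewrite addn1.
under [in X in _ = X]eq_bigr do rewrite addn1.
move=> ->; lia.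
Qed.

Lemma central_binS (R : realFieldType) m :
  'C(m.+1.*2, m.+1)%:R
    = 'C(m.*2, m)%:R * (2 * (2 * m%:R + 1) / (m%:R + 1)) :> R.
Proof.
have e : (m%:R + 1) * 'C(m.*2.+1, m.+1)%:R = (2 * m%:R + 1) * 'C(m.*2, m)%:R :> R.
  by rewrite -[2]/(2%:R) -natrM !natr1 -!natrM -mul_bin_diag mul2n.
rewrite (bin_double (ltn0Sn m)) natrM /=.
have m1 : m%:R + 1 != 0 :> R by rewrite natr1 pnatr_eq0.
by apply: (mulfI m1); rewrite [LHS]mulrA e; field.
Qed.

(** The bound is [catalan R m / 3]. It passes from [m] to [m + 1] because consecutive Catalan
    numbers have ratio below 4 and [1/3 + 1 = 4/3]. *)
Lemma catalan_sum_ge (R : realFieldType) m : (1 < m)%N ->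
  'C(m.*2, m)%:R / (3 * (m%:R + 1)) <= \sum_(1 <= i < m) catalan R i.
Proof.
elim: m => // -[//|[_ _|m IHm _]].
  rewrite big_nat1 /catalan; have -> : 'C(2.*2, 2) = 6%N by [].
  have -> : 'C(1.*2, 1) = 2%N by [].
  by rewrite ler_pdivrMr; lra.
rewrite big_nat_recr //=; apply: le_trans (lerD (IHm isT) (lexx _)).
rewrite central_binS /catalan -[m.+3%:R]natr1.
have c0 : 0 <= 'C(m.+2.*2, m.+2)%:R :> R by [].
have : 2 <= m.+2%:R :> R by rewrite ler_nat.
set c := 'C(_, _)%:R in c0 *; set x := m.+2%:R => x2.
rewrite -!mulrA -mulrDr ler_wpM2l //.
rewrite -subr_ge0.
have -> : 
  (3 * (x + 1))^-1 + (x + 1)^-1 -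
  2 * ((2 * x + 1) * ((x + 1)^-1 * (3 * (x + 1 + 1))^-1)) = 2 / ((x+1) * (x+2)).
  by field; apply/andP; split; lra.
by rewrite divr_ge0 // mulr_ge0 //; lra.
Qed.

(** * Wallis' estimate of the central binomial coefficient *)

(* The antiderivative of [cos ^+ n] vanishing at 0. *)
Fixpoint cosX_prim (R : realType) (n : nat) (x : R) : R :=
  match n with
  | 0 => x
  | 1 => sin x
  | n'.+2 => (cos x ^+ n'.+1 * sin x + n'.+1%:R * cosX_prim n' x) / n'.+2%:R
  end.

Lemma cosX_primSS (R : realType) n (x : R) : cosX_prim n.+2 x
  = (cos x ^+ n.+1 * sin x + n.+1%:R * cosX_prim n x) / n.+2%:R.
Proof. by []. Qed.

Lemma is_derive_cosX_prim (R : realType) n (x : R) :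
  is_derive x 1 (@cosX_prim R n) (cos x ^+ n).
Proof.
elim/ltn_ind: n => -[|[|n]] IHn.
- by rewrite expr0; exact: is_derive_id.
- by rewrite expr1; exact: is_derive_sin.
have dn := IHn n (ltnW (ltnSn _)).
have df := is_deriveZ n.+2%:R^-1 (is_deriveD
  (is_deriveM (is_deriveX n.+1 (is_derive_cos x)) (is_derive_sin x))
  (is_deriveZ n.+1%:R dn)).
rewrite (_ : cosX_prim _ = n.+2%:R^-1 \*: (((@cos R) ^+ n.+1) * (@sin R)
    + n.+1%:R \*: cosX_prim n)); last first.
  by apply/funext => y /=; rewrite !fctE mulrC.
apply: (is_derive_eq df).
have sc := cos2Dsin2 x; rewrite !fctE /GRing.scale /=.
have n2 : n.+2%:R != 0 :> R by rewrite pnatr_eq0.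
apply: (mulfI n2); rewrite mulVKf // -[n.+2%:R]natr1 !exprS.
have -> : sin x * (n.+1%:R * cos x ^+ n * - sin x)
    = - n.+1%:R * cos x ^+ n * sin x ^+ 2 by ring.
rewrite (_ : sin x ^+ 2 = 1 - cos x ^+ 2); last by rewrite -sc addrC addKr.
ring.
Qed.

Lemma cosX_prim0 (R : realType) n : cosX_prim n (0 : R) = 0.
Proof.
elim/ltn_ind: n => -[|[|n]] IHn //=; first exact: sin0.
by rewrite sin0 IHn // !mulr0 addr0 mul0r.
Qed.

(** On the interval from 0 to [pi / 2] the cosine lies between 0 and 1, so the difference of the two
    primitives has nonnegative derivative there. *)
Lemma cosX_prim_pihalf_le (R : realType) n :
  cosX_prim n.+1 (pi / 2 : R) <= cosX_prim n (pi / 2).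
Proof.
pose f := (@cosX_prim R n : R -> R) - @cosX_prim R n.+1.
have df (x : R) : is_derive x 1 f (cos x ^+ n - cos x ^+ n.+1).
  by apply: is_deriveB; exact: is_derive_cosX_prim.
have pi0 : 0 <= pi / 2 :> R by rewrite divr_ge0 // pi_ge0.
have [|c] := MVT_segment pi0 (fun x _ => df x).
  apply: continuous_subspaceT => x.
  exact/differentiable_continuous/derivable1_diffP/ex_derive.
rewrite in_itv /= => /andP[c0 c1]; rewrite /f !fctE !cosX_prim0 subrr !subr0 => e.
have cos0 : 0 <= cos c.
  by rewrite cos_ge0_pihalf // c1 andbT (le_trans _ c0) // oppr_le0.
rewrite -subr_ge0 e mulr_ge0 // exprS -[X in X - _]mul1r -mulrBl.
by rewrite mulr_ge0 ?exprn_ge0 // subr_ge0 cos_le1.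
Qed.

Definition central (R : realType) (m : nat) : R := 'C(m.*2, m)%:R / 4 ^+ m.

Lemma central_gt0 (R : realType) m : 0 < central R m.
Proof. by rewrite divr_gt0 ?exprn_gt0 // ltr0n bin_gt0 -addnn leq_addr. Qed.

Lemma centralS (R : realType) m :
  central R m.+1 = central R m * ((2 * m%:R + 1) / (2 * m%:R + 2)).
Proof.
have m1 : m%:R + 1 != 0 :> R by rewrite natr1 pnatr_eq0.
have m2 : 2 * m%:R + 2 != 0 :> R by rewrite -[X in _ + X]mulr1 -mulrDr mulf_neq0.
by rewrite /central central_binS exprS; field; rewrite m1 m2 expf_neq0.
Qed.

(** The boundary term vanishes at [pi / 2], leaving Wallis' recursion, which [centralS] matches. *)
Lemma cosX_prim_pihalf (R : realType) m :
  cosX_prim m.*2 (pi / 2 : R) = pi / 2 * central R m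
  /\ cosX_prim m.*2.+1 (pi / 2 : R) = ((2 * m%:R + 1) * central R m)^-1.
Proof.
elim: m => [|m [IHe IHo]].
  by rewrite /= /central bin0 expr0 sin_pihalf mulr0 add0r divr1 !mulr1 invr1.
have m0 : 0 <= m%:R :> R by [].
have c0 := lt0r_neq0 (central_gt0 R m).
rewrite centralS doubleS !cosX_primSS cos_pihalf !expr0n !mul0r !add0r IHe IHo.
have -> : m.*2.+1%:R = 2 * m%:R + 1 :> R by rewrite -natr1 -muln2 natrM; ring.
have -> : m.*2.+2%:R = 2 * m%:R + 2 :> R by rewrite -!natr1 -muln2 natrM; ring.
have -> : m.*2.+3%:R = 2 * m%:R + 3 :> R by rewrite -!natr1 -muln2 natrM; ring.
rewrite -natr1.
split; first by field; lra.
by field; rewrite c0 /=; repeat (apply/andP; split); lra.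
Qed.

Lemma wallis_le (R : realType) m :
  2 <= pi * (2 * m%:R + 1) * central R m ^+ 2 :> R.
Proof.
have := cosX_prim_pihalf_le R m.*2; have [-> ->] := cosX_prim_pihalf R m.
have m0 : 0 <= m%:R :> R by [].
have c0 := central_gt0 R m.
rewrite -div1r ler_pdivrMr; last by rewrite mulr_gt0 //; lra.
by move=> h; rewrite expr2; lra.
Qed.

(* [64 m ^ 3 / (8 m - 1) ^ 2 * central m ^ 2] is nonincreasing in [m], and by
   [wallis_le] its limit is at least [1 / pi]. *)
Lemma central_sqr_ge (R : realType) m : (0 < m)%N ->
  (1 - 1 / (8 * m%:R)) ^+ 2 <= pi * m%:R * central R m ^+ 2.
Proof.
(* This is [k * central R k ^+ 2] divided by the square of [1 - 1 / (8 * k)], so the goal becomes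
   [1 <= pi * w m]. *)
pose w k : R := 64 * k%:R ^+ 3 / (8 * k%:R - 1) ^+ 2 * central R k ^+ 2.
have w_decr k : (0 < k)%N -> w k.+1 <= w k.
  move=> k0; rewrite /w centralS -[k.+1%:R]natr1.
  have : 1 <= k%:R :> R by rewrite ler1n.
  set c := central R k; set x : R := k%:R => x1; rewrite -subr_ge0.
  have -> : 64 * x ^+ 3 / (8 * x - 1) ^+ 2 * c ^+ 2
      - 64 * (x + 1) ^+ 3 / (8 * (x + 1) - 1) ^+ 2
        * (c * ((2 * x + 1) / (2 * x + 2))) ^+ 2
      = c ^+ 2 * (16 * (8 * x ^+ 2 + 11 * x - 1)
        / ((8 * x - 1) ^+ 2 * (8 * x + 7) ^+ 2)).
    by field; repeat (apply/andP; split); lra.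
  by rewrite mulr_ge0 ?sqr_ge0 // divr_ge0 ?mulr_ge0 ?sqr_ge0 //; nra.
have w_le k j : (0 < k)%N -> w (k + j)%N <= w k.
  move=> k0; elim: j => [|j IHj]; first by rewrite addn0.
  by rewrite addnS (le_trans (w_decr _ _) IHj) // addn_gt0 k0.
move=> m0.
have pi0 := pi_gt0 R.
suff : 1 <= pi * w m.
  have m1 : 1 <= m%:R :> R by rewrite ler1n.
  rewrite /w => h.
  have -> : 1 - 1 / (8 * m%:R) = (8 * m%:R - 1) / (8 * m%:R) :> R by field; lra.
  have d0 : 0 < (8 * m%:R) ^+ 2 / (8 * m%:R - 1) ^+ 2 :> R.
    by rewrite divr_gt0 ?exprn_gt0 //; lra.
  rewrite -(ler_pM2l d0); apply: etrans h; congr (_ <= _); field.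
    by apply/andP; split; lra.
  by lra.
apply/ler_addgt0Pr => e e0.
(* In place of a limit: once [m + j] exceeds [e^-1], [wallis_le] gives [pi * w (m + j) >= 1 - e]. *)
have [j je] : exists j : nat, e^-1 < j%:R.
  by exists (Num.bound e^-1); rewrite archi_boundP // invr_ge0 ltW.
have := w_le m j m0; rewrite -(ler_pM2l pi0) => h.
rewrite -lerBlDr (le_trans _ h) //.
have k1 : 1 <= (m + j)%:R :> R by rewrite ler1n addn_gt0 m0.
have je' : e^-1 < (m + j)%:R by rewrite (lt_le_trans je) // ler_nat leq_addl.
have := wallis_le R (m + j); rewrite /w; have := sqr_ge0 (central R (m + j)).
set c := central R _ ^+ 2; move: k1 je'; set x : R := (m + j)%:R => x1 ex c0 wal.
have : 1 < e * x by rewrite -ltr_pdivrMl // mulr1.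
move=> ex1.
have y0 : 0 <= pi * c by rewrite mulr_ge0 // ltW.
have q1 : 1 <= (8 * x) ^+ 2 / (8 * x - 1) ^+ 2.
  by rewrite ler_pdivlMr ?exprn_gt0 //; nra.
have -> : pi * (64 * x ^+ 3 / (8 * x - 1) ^+ 2 * c)
    = pi * c * x * ((8 * x) ^+ 2 / (8 * x - 1) ^+ 2) by field; lra.
have yx : 0 <= pi * c * x by rewrite mulr_ge0 //; lra.
rewrite (le_trans _ (ler_peMr yx q1)) //.
rewrite mulrAC in wal.
set y := pi * c in wal y0 yx *; nra.
Qed.

Lemma central_ge (R : realType) m : (0 < m)%N ->
  1 - 1 / (8 * m%:R) <= Num.sqrt (pi * m%:R) * central R m.
Proof.
move=> m0; have := central_sqr_ge R m0.
have pm0 : 0 <= pi * m%:R :> R by rewrite mulr_ge0 ?pi_ge0.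
have c0 := ltW (central_gt0 R m).
rewrite -[X in X * _ ^+ 2](sqr_sqrtr pm0) -exprMn => h.
have : 0 <= Num.sqrt (pi * m%:R) * central R m by rewrite mulr_ge0 ?sqrtr_ge0.
by move: h; set y := _ * central R m; set z := 1 - _; nra.
Qed.

(** * Asymptotic form of the bounds *)

(** Cancels [pi] between the main term and [central_ge]. The remaining root is 1 for [k = n/2] and
    that of [(n + 1)/n] for [k = (n + 1)/2]. *)
Lemma gauss_mul_sqrt (R : realType) n k : (0 < n)%N ->
  Num.sqrt (2 / pi) * (2 ^+ n / Num.sqrt n%:R) * Num.sqrt (pi * k%:R)
    = 2 ^+ n * Num.sqrt (2 * k%:R / n%:R) :> R.
Proof.
move=> n0; move: (pi : R) (pi_gt0 R) => p p0.
have n0' : 0 < n%:R :> R by rewrite ltr0n.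
have -> : 2 * k%:R / n%:R = (2 / p) * (p * k%:R) / n%:R :> R.
  by field; rewrite !lt0r_neq0.
have p2 : 0 <= 2 / p by rewrite divr_ge0 // ltW.
have pk : 0 <= p * k%:R by rewrite mulr_ge0 // ltW.
rewrite (sqrtrM _ (mulr_ge0 p2 pk)) (sqrtrM _ p2) sqrtrV ?(ltW n0') //.
ring.
Qed.

(** With [n = 2 m], [central_ge] contributes [-1/(4n)] and the Catalan sum about [2/(3n)], in total
    [5/(12n)]. The constant 10 absorbs the error and makes the case [n = 2] trivial, since the left
    side is then not positive. *)
Lemma min_largest_element_even_ge (R : realType) m : (0 < m)%N ->
  Num.sqrt (2 / pi) * (2 ^+ m.*2 / Num.sqrt m.*2%:R)
    * (1 + 5 / (12 * m.*2%:R) - 10 * m.*2%:R ^- 2)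
  <= (min_largest_element m.*2)%:R :> R.
Proof.
move=> m0; set g := Num.sqrt _ * _.
have g0 : 0 <= g by rewrite mulr_ge0 ?divr_ge0 ?exprn_ge0 ?sqrtr_ge0.
have m2E : m.*2%:R = 2 * m%:R :> R by rewrite -mul2n natrM.
have [->|m1] := eqVneq m 1%N.
  apply: le_trans (_ : 0 <= _) => //; rewrite mulr_ge0_le0 //.
  by have -> : 1.*2%:R = 2 :> R by []; lra.
have m2 : (1 < m)%N by lia.
apply: le_trans (min_largest_element_even R m0).
apply: le_trans (lerD (lexx _) (catalan_sum_ge R m2)).
have binE : 'C(m.*2, m)%:R = g * (Num.sqrt (pi * m%:R) * central R m) :> R.
  rewrite mulrA gauss_mul_sqrt ?double_gt0 // m2E divff ?sqrtr1; last first.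
    by rewrite mulf_neq0 // pnatr_eq0 -lt0n.
  by rewrite mulr1 /central -mul2n exprM -natrX mulrC natrX divfK // expf_neq0.
rewrite -[X in _ <= X + _]mulr1 -mulrDr binE -[X in _ <= X]mulrA ler_wpM2l //.
have x2 : 2 <= m%:R :> R by rewrite ler_nat.
have := central_ge R m0; rewrite m2E; set y := _ * central R m.
set x : R := m%:R in x2 *; set q := 1 + (3 * (x + 1))^-1.
have q0 : 0 <= q by rewrite addr_ge0 // invr_ge0; lra.
move=> /(ler_wpM2r q0); apply: le_trans; rewrite -subr_ge0.
have -> : (1 - 1 / (8 * x)) * q - (1 + 5 / (12 * (2 * x)) - 10 * (2 * x) ^- 2)
   = (51 * x + 60) / (24 * x ^+ 2 * (x + 1)).
  by rewrite /q; field; apply/andP; split; lra.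
by rewrite divr_ge0 ?mulr_ge0 ?sqr_ge0 //; lra.
Qed.

(** With [n = 2 m + 1], the first-order terms are [-1/(4n)] from [central_ge] at [m + 1], [-1/(2n)]
    from [pow_ge] and [4/(3n)] from the Catalan sum, in total [7/(12n)]. *)
Lemma min_largest_element_odd_ge (R : realType) m :
  Num.sqrt (2 / pi) * (2 ^+ m.*2.+1 / Num.sqrt m.*2.+1%:R)
    * (1 + 7 / (12 * m.*2.+1%:R) - 10 * m.*2.+1%:R ^- 2)
  <= (min_largest_element m.*2.+1)%:R :> R.
Proof.
set g := Num.sqrt _ * _.
have g0 : 0 <= g by rewrite mulr_ge0 ?divr_ge0 ?exprn_ge0 ?sqrtr_ge0.
have [->|m0] := posnP m.
  apply: le_trans (_ : 0 <= _) => //; rewrite mulr_ge0_le0 //.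
  by have -> : 0.*2.+1%:R = 1 :> R by []; lra.
have kE : 2 * m.+1%:R = m.*2.+1%:R + 1 :> R by rewrite natr1 -natrM mul2n doubleS.
apply: le_trans (min_largest_element_odd R m).
apply: le_trans (lerD (lexx _) (catalan_sum_ge R (m0 : 1 < m.+1)%N)).
have -> : 'C(m.*2.+1, m)%:R = 'C(m.+1.*2, m.+1)%:R / 2 :> R.
  rewrite bin_double // natrM mulfK //=.
  by congr _%:R; rewrite -[RHS]bin_sub; [congr 'C(_, _)|]; lia.
set n : R := m.*2.+1%:R in kE *.
have n3 : 3 <= n by rewrite ler_nat; lia.
(* After [gauss_mul_sqrt] the extra root of [(n + 1)/n] is cancelled by [1 - 1 / (2 * n)], a lower
   bound for its inverse. *)
have pow_ge : g * Num.sqrt (pi * m.+1%:R) * (1 - 1 / (2 * n)) <= 4 ^+ m.+1 / 2.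
  rewrite gauss_mul_sqrt // kE -/n.
  have -> : 4 ^+ m.+1 / 2 = 2 ^+ m.*2.+1 :> R.
    rewrite (_ : 4 = 2 ^+ 2) -?exprM ?mul2n ?doubleS
      ?[2 ^+ m.*2.+2]exprS; first by field.
    ring.
  rewrite -mulrA ler_piMr ?exprn_ge0 //.
  have h0 : 0 <= (n + 1) / n by rewrite divr_ge0; lra.
  have := sqr_sqrtr h0; have := sqrtr_ge0 ((n + 1) / n).
  set s := Num.sqrt _ => s0 sE.
  have t0 : 0 <= 1 - 1 / (2 * n).
    by rewrite subr_ge0 ler_pdivrMr; lra.
  have : (s * (1 - 1 / (2 * n))) ^+ 2 <= 1.
    rewrite exprMn sE -subr_ge0.
    have -> : 1 - (n + 1) / n * (1 - 1 / (2 * n)) ^+ 2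
       = (3 * n - 1) / (4 * n ^+ 3) by field; lra.
    by rewrite divr_ge0 // ?mulr_ge0 ?exprn_ge0 //; lra.
  by rewrite expr_le1 // mulr_ge0.
have binE : 'C(m.+1.*2, m.+1)%:R = 4 ^+ m.+1 * central R m.+1 :> R.
  by rewrite /central mulrC divfK // expf_neq0.
rewrite binE.
have -> : 4 ^+ m.+1 * central R m.+1 / 2
    + 4 ^+ m.+1 * central R m.+1 / (3 * (m.+1%:R + 1))
  = 4 ^+ m.+1 / 2 * (central R m.+1 * (1 + 4 / (3 * (n + 3)))).
  have -> : n = 2 * m.+1%:R - 1 by rewrite kE addrK.
  have : 0 <= m.+1%:R :> R by []. move=> ?.
  by field; apply/andP; split; lra.
have r0 : 0 <= 1 + 4 / (3 * (n + 3)) by rewrite addr_ge0 // divr_ge0 //; lra.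
have cr0 : 0 <= central R m.+1 * (1 + 4 / (3 * (n + 3))).
  by rewrite mulr_ge0 // ltW // central_gt0.
apply: le_trans (ler_wpM2r cr0 pow_ge).
have := central_ge R (ltn0Sn m).
set c := central R m.+1; set s := Num.sqrt (pi * _) => sc.
have -> : g * s * (1 - 1 / (2 * n)) * (c * (1 + 4 / (3 * (n + 3))))
  = g * (s * c * ((1 - 1 / (2 * n)) * (1 + 4 / (3 * (n + 3))))) by ring.
rewrite ler_wpM2l //.
have t0 : 0 <= (1 - 1 / (2 * n)) * (1 + 4 / (3 * (n + 3))).
  by rewrite mulr_ge0 // subr_ge0 ler_pdivrMr; lra.
apply: le_trans (ler_wpM2r t0 sc).
have -> : 8 * m.+1%:R = 4 * (n + 1) :> R by rewrite -kE; ring.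
rewrite -subr_ge0.
have -> : (1 - 1 / (4 * (n + 1))) * ((1 - 1 / (2 * n)) * (1 + 4 / (3 * (n + 3))))
    - (1 + 7 / (12 * n) - 10 * n ^- 2)
  = (129 * n ^+ 2 + 879 * n + 720) / (24 * n ^+ 2 * ((n + 1) * (n + 3))).
  by field; repeat (apply/andP; split); lra.
have nn0 := sqr_ge0 n.
by apply: divr_ge0; [lra | apply: mulr_ge0; [lra | apply: mulr_ge0; lra]].
Qed.

Lemma bigO_inv_sqr (R : realType) :
  (fun n : nat => - 10 * n%:R ^- 2 : R) =O_\oo (fun n : nat => n%:R ^- 2 : R).
Proof.
apply/eqO_exP; exists 10; first by rewrite ltr0n.
by near=> n; rewrite /= normrM normrN normr_nat.
Unshelve. all: by end_near. Qed.

Theorem corollary5p3 (R : realType) :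
  (exists eps : nat -> R,
      eps =O_\oo (fun n : nat => n%:R ^- 2 : R)
      /\ forall n : nat, (0 < n)%N -> ~~ odd n ->
           (min_largest_element n)%:R >=
             Num.sqrt (2 / pi) * (2 ^+ n / Num.sqrt n%:R)
             * (1 + 5 / (12 * n%:R) + eps n))
  /\
  (exists eps : nat -> R,
      eps =O_\oo (fun n : nat => n%:R ^- 2 : R)
      /\ forall n : nat, odd n ->
           (min_largest_element n)%:R >=
             Num.sqrt (2 / pi) * (2 ^+ n / Num.sqrt n%:R)
             * (1 + 7 / (12 * n%:R) + eps n)).
Proof.
split; exists (fun n => - 10 * n%:R ^- 2); split.
- exact: bigO_inv_sqr.
- move=> n n0 n_even.
  have [m -> m0] : exists2 m, n = m.*2 & (0 < m)%N.
    exists n./2; first by rewrite -[LHS]odd_double_half (negPf n_even).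
    by case: n n0 n_even => [|[]].
  by have := min_largest_element_even_ge R m0; rewrite mulNr.
- exact: bigO_inv_sqr.
move=> n n_odd.
have [m ->] : exists m, n = m.*2.+1.
  by exists n./2; rewrite -[LHS]odd_double_half n_odd.
by have := min_largest_element_odd_ge R m; rewrite mulNr.
Qed.
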